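(* For all choices of point sets $X=\{x_1,\ldots,x_n\}$ and function values $y_1,\ldots,y_n$ it cannot be decided whether the flat limit is error-optimal or not. More precisely, there are functions $f$ that attain the values $y_j=f(x_j)$, $1\leq j\leq n$, and have an optimal flat limit or not; that is, some functions attaining these values have an optimal flat limit, and some functions attaining these values do not.
   Context: $\Phi$ is a positive definite analytic radial kernel, i.e. one with a convergent expansion into powers of $\|x-y\|_2^2$ (such as the Gaussian or inverse multiquadrics), and $\Phi_\epsilon(x)=\Phi(\epsilon x)$ for scales $\epsilon>0$. For a set $X=\{x_1,\ldots,x_n\}\subset\mathbb{R}^d$ of $n$ points and a function $f$, the interpolant $s_{f,X,\Phi_\epsilon}$ is the linear combination of the functions $\Phi_\epsilon(\cdot-x_j)$, $1\leq j\leq n$, that takes the values $f(x_j)$ at $x_j$, $1\leq j\leq n$. Degenerate situations are ignored: under the usual nondegeneracy conditions, the limit of the interpolant for $\epsilon\to0$ (the flat limit) exists and is a polynomial $p_{0,f}$ interpolating the data of $f$ on $X$, and there is an expansion $s_{f,X,\Phi_\epsilon}(x)=p_{0,f}(x)+\epsilon^2p_{2,f}(x)+\epsilon^4p_{4,f}(x)+\cdots$, where the $p_{2j,f}$, $j\geq1$, are polynomials vanishing on $X$ that have the form $p_{2j,f}=\sum_{i=1}^n f(x_i)p_{2j,i}$ with polynomials $p_{2j,i}$ depending only on $X$ and $\Phi$. A scale is error-optimal for $f$ if it minimizes the norm of the error $f-s_{f,X,\Phi_\epsilon}$ over all scales, where the norm is the supremum norm on the domain under consideration (which contains $X$) and the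 flat limit is included as the scale $\epsilon=0$, with interpolant $p_{0,f}$. The flat limit is called optimal (error-optimal) for $f$ if $\epsilon=0$ is error-optimal in this sense.
   Formalization: The existence of a function without an optimal flat limit is stated only when some value y_j is nonzero; if all y_j vanish, every interpolant and the flat limit are zero, so all scales give the same error and the flat limit is always optimal. *)

(* Defs.v *)
From HB Require Import structures.
From mathcomp Require Import all_boot all_order all_algebra.
From mathcomp Require Import all_classical all_reals all_analysis.
(* Not imported: its notations clash with those of MathComp-Analysis. *)
From mathcomp Require mpoly.

Set Implicit Arguments.
Unset Strict Implicit.
Unset Printing Implicit Defensive.

Import Order.TTheory GRing.Theory Num.Theory.
Import numFieldNormedType.Exports.

Local Open Scope classical_set_scope.
Local Open Scope ring_scope.

(* The canonical norm of ['rV[R]_d] is the maximum norm, hence this explicit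
   squared Euclidean norm. *)
Definition sqnorm2 (R : realType) (d : nat) (x : 'rV[R]_d) : R :=
  \sum_(i < d) x ord0 i ^+ 2.

(* The expansion is only required to converge for small arguments: that of the
   inverse multiquadric (1 + |x|^2)^(-1/2) has radius 1. *)
Definition analytic_radial (R : realType) (d : nat) (Phi : 'rV[R]_d -> R) : Prop :=
  exists phi : R -> R,
    (forall x, Phi x = phi (sqnorm2 x)) /\
    exists (a : nat -> R) (r : R), 0 < r /\
      forall t, 0 <= t < r ->
        series (fun k => a k * t ^+ k) n @[n --> \oo] --> phi t.

(* Strict, as is usual for kernels used for interpolation. *)
Definition positive_definite (R : realType) (d : nat) (Phi : 'rV[R]_d -> R) : Prop :=
  forall (m : nat) (Z : 'I_m -> 'rV[R]_d) (c : 'I_m -> R),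
    injective Z -> (exists i, c i != 0) ->
    0 < \sum_(i < m) \sum_(j < m) c i * c j * Phi (Z i - Z j).

Definition kernel_mx (R : realType) (d n : nat) (Phi : 'rV[R]_d -> R)
    (X : 'I_n -> 'rV[R]_d) (eps : R) : 'M[R]_n :=
  \matrix_(i < n, j < n) Phi (eps *: (X j - X i)).

Definition interp_coef (R : realType) (d n : nat) (Phi : 'rV[R]_d -> R)
    (X : 'I_n -> 'rV[R]_d) (f : 'rV[R]_d -> R) (eps : R) : 'rV[R]_n :=
  (\row_(j < n) f (X j)) *m invmx (kernel_mx Phi X eps).

(* For eps > 0; see [interpolantP] for the characterization. *)
Definition interpolant (R : realType) (d n : nat) (Phi : 'rV[R]_d -> R)
    (X : 'I_n -> 'rV[R]_d) (f : 'rV[R]_d -> R) (eps : R) (x : 'rV[R]_d) : R :=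
  \sum_(j < n) interp_coef Phi X f eps ord0 j * Phi (eps *: (x - X j)).

Definition flat_limit (R : realType) (d n : nat) (Phi : 'rV[R]_d -> R)
    (X : 'I_n -> 'rV[R]_d) (f : 'rV[R]_d -> R) (x : 'rV[R]_d) : R :=
  lim (interpolant Phi X f eps x @[eps --> 0^'+]).

Definition scaled_interpolant (R : realType) (d n : nat) (Phi : 'rV[R]_d -> R)
    (X : 'I_n -> 'rV[R]_d) (f : 'rV[R]_d -> R) (eps : R) : 'rV[R]_d -> R :=
  if eps == 0 then flat_limit Phi X f else interpolant Phi X f eps.

Definition poly_eval (R : realType) (d : nat) (p : mpoly.mpoly d R)
    (x : 'rV[R]_d) : R :=
  mpoly.meval (fun i => x ord0 i) p.

(* [p k i] is the polynomial p_{2k,i}; these are chosen before [f].  For fixed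
   [x] the expansion converges for all sufficiently small scales. *)
Definition flat_nondegenerate (R : realType) (d n : nat) (Phi : 'rV[R]_d -> R)
    (X : 'I_n -> 'rV[R]_d) : Prop :=
  exists p : nat -> 'I_n -> mpoly.mpoly d R,
    forall f : 'rV[R]_d -> R,
    let P k x := \sum_(i < n) f (X i) * poly_eval (p k i) x in
    [/\ forall x, interpolant Phi X f eps x @[eps --> 0^'+] --> P 0%N x,
        forall j, P 0%N (X j) = f (X j),
        forall k j, (0 < k)%N -> P k (X j) = 0
      & forall x, \forall eps \near 0^'+,
          series (fun k => eps ^+ (2 * k) * P k x) m @[m --> \oo]
            --> interpolant Phi X f eps x].

Definition sup_norm (R : realType) (d : nat) (Omega : set 'rV[R]_d)
    (g : 'rV[R]_d -> R) : \bar R :=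
  ereal_sup [set (`|g x|)%:E | x in Omega].

Definition error_optimal (R : realType) (d n : nat) (Phi : 'rV[R]_d -> R)
    (X : 'I_n -> 'rV[R]_d) (Omega : set 'rV[R]_d) (f : 'rV[R]_d -> R)
    (eps : R) : Prop :=
  0 <= eps /\
  forall delta : R, 0 <= delta ->
    (sup_norm Omega (f \- scaled_interpolant Phi X f eps)%R <=
     sup_norm Omega (f \- scaled_interpolant Phi X f delta)%R)%E.

Definition flat_limit_optimal (R : realType) (d n : nat) (Phi : 'rV[R]_d -> R)
    (X : 'I_n -> 'rV[R]_d) (Omega : set 'rV[R]_d) (f : 'rV[R]_d -> R) : Prop :=
  error_optimal Phi X Omega f 0.

Lemma kernel_mx_unit (R : realType) (d n : nat) (Phi : 'rV[R]_d -> R)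
    (X : 'I_n -> 'rV[R]_d) (eps : R) :
  positive_definite Phi -> injective X -> 0 < eps ->
  kernel_mx Phi X eps \in unitmx.
Proof.
move=> pd Xinj e0; rewrite -row_free_unit -kermx_eq0.
apply/eqP/row_matrixP => i; rewrite row0.
set v := row i _.
have vK : v *m kernel_mx Phi X eps = 0.
  by rewrite /v -row_mul mulmx_ker row0.
clearbody v.
apply/rowP => j; rewrite [RHS]mxE; apply/eqP/negPn/negP => vj.
have Zinj : injective (fun k => eps *: X k).
  by move=> k l /(scalerI (lt0r_neq0 e0)) /Xinj.
have := pd n _ (fun k => v ord0 k) Zinj (ex_intro _ j vj).
rewrite big1 ?ltxx// => k _.
have := congr1 (fun M : 'rV[R]_n => M ord0 k) vK.
rewrite !mxE => /(congr1 ( *%R (v ord0 k))); rewrite mulr0 mulr_sumr => h.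
rewrite -[RHS]h; apply: eq_bigr => l _.
by rewrite mxE scalerBr mulrA.
Qed.

Lemma interpolantP (R : realType) (d n : nat) (Phi : 'rV[R]_d -> R)
    (X : 'I_n -> 'rV[R]_d) (f : 'rV[R]_d -> R) (eps : R) (c : 'rV[R]_n) :
  positive_definite Phi -> injective X -> 0 < eps ->
  (forall i, \sum_(j < n) c ord0 j * Phi (eps *: (X i - X j)) = f (X i)) <->
  c = interp_coef Phi X f eps.
Proof.
move=> pd Xinj e0; have KU := kernel_mx_unit pd Xinj e0.
have E i : \sum_(j < n) c ord0 j * Phi (eps *: (X i - X j)) =
    (c *m kernel_mx Phi X eps) ord0 i.
  by rewrite mxE; apply: eq_bigr => j _; rewrite mxE.
split=> [h|-> i].
  rewrite /interp_coef -[c in LHS](mulmxK KU); congr (_ *m _).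
  by apply/rowP => i; rewrite -E h mxE.
have -> : f (X i) = (interp_coef Phi X f eps *m kernel_mx Phi X eps) ord0 i.
  by rewrite mulmxKV// mxE.
rewrite [RHS]mxE; apply: eq_bigr => j _; congr (_ * _); by rewrite mxE.
Qed.

(* Main.v *)
Require Import Defs.
From HB Require Import structures.
From mathcomp Require Import all_boot all_order all_algebra.
From mathcomp Require Import all_classical all_reals all_analysis.
From mathcomp Require mpoly.

Import Order.TTheory GRing.Theory Num.Theory.
Import numFieldNormedType.Exports.

Local Open Scope classical_set_scope.
Local Open Scope ring_scope.

(** The flat limit [p0] is a function with the prescribed values, and depends
    on the data only through these values.  Hence for [f := p0] the error at
    the scale [0] vanishes and the flat limit is optimal.

    For the other half, if the flat limit were optimal for every function
    with the prescribed values, then it would be optimal for the interpolant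
    [s_eps] at an arbitrary scale [eps > 0]; as the error of [s_eps] at its
    own scale is zero, [s_eps = p0] on [Omega] for all [eps > 0]
    ([interpolant_eq_flat_limit]).  Two steps refute this for nonzero data.

    - From [Omega] to the whole space ([expansion_constant]).  For [x] in
      [Omega] the expansion of [s_eps x] in powers of [eps ^+ 2] is the
      constant [p0 x], so all its higher coefficients vanish at [x].  They are
      polynomials in [x] and [Omega] has an interior point, so they vanish
      identically.  Hence [s_eps x = p0 x] for every [x] in the space, once
      [eps] is small enough depending on [x].

    - The interpolants of nonzero data cannot agree in this way with a
      polynomial ([poly_interpolant_eq0]).
      Write [s_eps = \sum_j c j * Phi (eps *: (x - X j))] with [c] nonzero,
      and take a finite difference in a direction [h], with weights [w l],
      which annihilates [p0].  Put the weights [c j * w l], not all zero, on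
      the points [X j + l *: h].  Their quadratic form for the scaled kernel is
      a combination of values of this difference of [s_eps], hence zero, which
      contradicts positive definiteness.  Only finitely many points are
      involved, so one common small [eps] serves for all. *)

(** * Uniqueness of power series coefficients *)

Lemma power_series_shift {R : realType} (v : nat -> R) (t : R) : t != 0 ->
  series (fun k => t ^+ k * v k) n @[n --> \oo] --> v 0%N ->
  series (fun k => t ^+ k * v k.+1) n @[n --> \oo] --> 0.
Proof.
move=> t0 h.
have e n : series (fun k => t ^+ k * v k.+1) n =
    t^-1 * (series (fun k => t ^+ k * v k) n.+1 - v 0%N).
  rewrite !seriesEnat /= big_nat_recl // expr0 mul1r addrC addrA addNr add0r.
  rewrite mulr_sumr; apply: eq_bigr => k _.
  by rewrite exprS !mulrA mulVf // mul1r.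
have -> : series (fun k => t ^+ k * v k.+1) =
    (fun n => t^-1 * (series (fun k => t ^+ k * v k) n.+1 - v 0%N)).
  by apply/funext.
rewrite -(mulr0 t^-1) -(subrr (v 0%N)).
apply: cvgM; first exact: cvg_cst.
apply: cvgB; last exact: cvg_cst.
by move: h; rewrite -(cvg_shiftS (series _)).
Qed.

(** The terms of a series that converges at [t = r / 2] are bounded by some
    [M], so for [0 < q < 1] its tail at [q * t] is at most
    [M * q / (1 - q)].  As the sum is zero, this bounds [v 0], and [q] can be
    arbitrarily small. *)
Lemma power_series_head_eq0 {R : realType} (v : nat -> R) (r : R) : 0 < r ->
  (forall t, 0 < t < r ->
     series (fun k => t ^+ k * v k) n @[n --> \oo] --> 0) ->
  v 0%N = 0.
Proof.
move=> r0 h; set t := r / 2.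
have t0 : 0 < t by rewrite divr_gt0.
have tr : t < r by rewrite ltr_pdivrMr // ltr_pMr // ltr1n.
have : cvgn (series (fun k => t ^+ k * v k)).
  by apply/cvg_ex; exists 0; apply: h; rewrite t0 tr.
move=> /cvg_series_cvg_0 /cvgP /cvg_seq_bounded.
move=> /pinfty_ex_gt0[M M0 hM].
have small q : 0 < q < 1 -> `|v 0%N| <= M * q / (1 - q).
  move=> /andP[q0 q1].
  have qt : 0 < q * t < r.
    by rewrite mulr_gt0 //= (lt_trans _ tr)// gtr_pMl.
  have c1 : series (fun k => (q * t) ^+ k * v k) n.+1 - v 0%N @[n --> \oo]
      --> 0 - v 0%N.
    apply: cvgB; last exact: cvg_cst.
    by have := h _ qt; rewrite -(cvg_shiftS (series _)).
  rewrite -[leLHS]normrN -sub0r.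
  apply: (closed_cvg _ (@closed_le _ _) _ _ (cvg_norm c1)).
  apply: nearW => n /=.
  rewrite seriesEnat /= big_nat_recl // expr0 mul1r addrC addrA addNr add0r.
  apply: le_trans (ler_norm_sum _ _ _) _.
  apply: (@le_trans _ _ (series (geometric (M * q) q) n)); last first.
    by apply: geometric_le_lim; rewrite ?mulr_ge0 ?ltW// ger0_norm // ltW.
  rewrite seriesEnat /=; apply: ler_sum => k _.
  have qk : 0 <= q ^+ k.+1 by rewrite exprn_ge0 // ltW.
  rewrite exprMn -mulrA normrM (ger0_norm qk) -mulrA -exprS [leRHS]mulrC.
  by rewrite ler_wpM2l //; exact: hM.
(* With q = e / (M + e) the bound M * q / (1 - q) is exactly e. *)
apply/eqP; rewrite -normr_le0; apply/ler_addgt0Pl => e e0; rewrite addr0.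
have Me : 0 < M + e by rewrite addr_gt0.
have q0 : 0 < e / (M + e) by rewrite divr_gt0.
have q1 : e / (M + e) < 1 by rewrite ltr_pdivrMr // mul1r ltrDr.
apply: le_trans (small (e / (M + e)) _) _; first by rewrite q0.
have -> : 1 - e / (M + e) = M / (M + e).
  by rewrite -[1](divff (lt0r_neq0 Me)) -mulrBl addrK.
by rewrite ler_pdivrMr ?divr_gt0 // mulrCA.
Qed.

Lemma power_series_tail_eq0 {R : realType} (v : nat -> R) (r : R) : 0 < r ->
  (forall t, 0 < t < r ->
     series (fun k => t ^+ k * v k) n @[n --> \oo] --> v 0%N) ->
  forall k, v k.+1 = 0.
Proof.
move=> r0 h k; elim: k v h => [|k IH] v h.
  apply: (power_series_head_eq0 (fun k => v k.+1) r) => // t /[dup] /andP[t0 _].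
  by move=> /h; apply: power_series_shift; rewrite lt0r_neq0.
apply: (IH (fun k => v k.+1)) => t /[dup] /andP[t0 _] tr.
rewrite (power_series_head_eq0 (fun k => v k.+1) r) //.
  by apply: power_series_shift; rewrite ?lt0r_neq0 //; apply: h.
move=> u /[dup] /andP[u0 _] ur.
by apply: power_series_shift; rewrite ?lt0r_neq0 //; apply: h.
Qed.

(** * Functions that are polynomial on every line *)

(** Restriction to lines is all that the argument sees of a multivariate
    polynomial: it suffices both for vanishing from an open set and for
    killing by finite differences in one direction. *)
Definition poly_on_lines {R : realType} {d : nat} (Q : 'rV[R]_d -> R) :=
  forall b w, exists q : {poly R}, forall t, q.[t] = Q (b + t *: w).

Lemma poly_on_lines_eval {R : realType} {d : nat} (p : mpoly.mpoly d R) :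
  poly_on_lines (poly_eval p).
Proof.
move=> b w; exists (mpoly.mmap polyC
  (fun i => (b ord0 i)%:P + (w ord0 i)%:P * 'X) p) => t.
rewrite /poly_eval mpoly.mevalE /mpoly.mmap horner_sum.
apply: eq_bigr => m _; rewrite hornerM hornerC /mpoly.mmap1 horner_prod.
congr (_ * _); apply: eq_bigr => i _.
by rewrite horner_exp !hornerE !mxE [t * _]mulrC.
Qed.

Lemma poly_on_lines_comb {R : realType} {d n : nat}
    (p : 'I_n -> mpoly.mpoly d R) (c : 'I_n -> R) :
  poly_on_lines (fun x => \sum_(i < n) c i * poly_eval (p i) x).
Proof.
move=> b w; have [q hq] := choice (fun i => poly_on_lines_eval (p i) b w).
exists (\sum_(i < n) c i *: q i) => t.
by rewrite horner_sum; apply: eq_bigr => i _; rewrite hornerZ hq.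
Qed.

Lemma poly_eq0_itv {R : realType} (q : {poly R}) (r : R) : 0 < r ->
  (forall t, 0 < t < r -> q.[t] = 0) -> q = 0.
Proof.
move=> r0 h; apply/eqP/negPn/negP => q0.
pose rs := [seq r / k.+2%:R | k <- iota 0 (size q)].
have := @max_poly_roots _ q rs q0.
rewrite size_map size_iota ltnn => H; suff : false by []; apply: H.
  apply/allP => _ /mapP[k _ ->]; rewrite rootE h //.
  by rewrite divr_gt0 //= ltr_pdivrMr // ltr_pMr // ltr1n.
rewrite map_inj_uniq ?iota_uniq // => i j /(mulfI (lt0r_neq0 r0)) /invr_inj.
by move=> /eqP; rewrite eqr_nat => /eqP [].
Qed.

(** Any point is joined by a line to an interior point of [Omega], near which
    the restriction to this line has infinitely many zeros. *)
Lemma poly_on_lines_open_eq0 {R : realType} {d : nat} (Q : 'rV[R]_d -> R)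
    (Omega : set 'rV[R]_d) :
  poly_on_lines Q ->
  interior Omega !=set0 -> (forall x, Omega x -> Q x = 0) ->
  forall x, Q x = 0.
Proof.
move=> hQ [b /nbhs_ballP[e /= e0 be]] Q0 x.
have [q hq] := hQ b (x - b).
suff q0 : q = 0 by rewrite -(subrK b x) addrC -[x - b]scale1r -hq q0 horner0.
have N : 0 < 1 + `|x - b| by rewrite ltr_pwDl.
apply: (@poly_eq0_itv _ _ (e / (1 + `|x - b|))) => [|t /andP[t0 te]].
  by rewrite divr_gt0.
rewrite hq; apply/Q0/be; rewrite -ball_normE /ball_ /= opprD addrA subrr add0r.
rewrite normrN normrZ gtr0_norm //; move: te; rewrite ltr_pdivlMr //.
by apply: le_lt_trans; rewrite ler_wpM2l ?ltW // ltrDr.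
Qed.

(** * Interpolants, flat limits and errors *)

Lemma interp_coef_data {R : realType} {d n : nat} (Phi : 'rV[R]_d -> R)
    (X : 'I_n -> 'rV[R]_d) (f g : 'rV[R]_d -> R) :
  (forall j, f (X j) = g (X j)) ->
  interp_coef Phi X f = interp_coef Phi X g.
Proof.
move=> fg; apply/funext => eps; rewrite /interp_coef; congr (_ *m _).
by apply/rowP => j; rewrite !mxE.
Qed.

Lemma interpolant_data {R : realType} {d n : nat} (Phi : 'rV[R]_d -> R)
    (X : 'I_n -> 'rV[R]_d) (f g : 'rV[R]_d -> R) :
  (forall j, f (X j) = g (X j)) -> interpolant Phi X f = interpolant Phi X g.
Proof. by move=> fg; rewrite /interpolant (interp_coef_data Phi X f g fg). Qed.

Lemma flat_limit_data {R : realType} {d n : nat} (Phi : 'rV[R]_d -> R)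
    (X : 'I_n -> 'rV[R]_d) (f g : 'rV[R]_d -> R) :
  (forall j, f (X j) = g (X j)) -> flat_limit Phi X f = flat_limit Phi X g.
Proof. by move=> fg; rewrite /flat_limit (interpolant_data Phi X f g fg). Qed.

Lemma sup_norm_ge0 {R : realType} {d : nat} (Omega : set 'rV[R]_d)
    (g : 'rV[R]_d -> R) : Omega !=set0 -> (0 <= sup_norm Omega g)%E.
Proof.
move=> [x Ox]; apply: (@le_trans _ _ (`|g x|%:E)); first by rewrite lee_fin.
by apply: ereal_sup_ubound; exists x.
Qed.

Lemma sup_norm_le0P {R : realType} {d : nat} (Omega : set 'rV[R]_d)
    (g : 'rV[R]_d -> R) :
  (sup_norm Omega g <= 0)%E <-> forall x, Omega x -> g x = 0.
Proof.
split=> [h x Ox|h].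
  apply/eqP; rewrite -normr_le0 -lee_fin; apply: le_trans h.
  by apply: ereal_sup_ubound; exists x.
by apply: ge_ereal_sup => _ [x Ox <-]; rewrite h // normr0.
Qed.

Lemma interpolant_node {R : realType} {d n : nat} {Phi : 'rV[R]_d -> R}
    {X : 'I_n -> 'rV[R]_d} (f : 'rV[R]_d -> R) (eps : R) (j : 'I_n) :
  positive_definite Phi -> injective X -> 0 < eps ->
  interpolant Phi X f eps (X j) = f (X j).
Proof. by move=> pd Xinj e0; apply: (interpolantP f _ pd Xinj e0).2. Qed.

(** The flat limit takes the same values at the nodes as [f], so it is its own
    flat limit. *)
Lemma flat_limit_optimal_self {R : realType} {d n : nat}
    (Phi : 'rV[R]_d -> R) (X : 'I_n -> 'rV[R]_d) (Omega : set 'rV[R]_d)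
    (f : 'rV[R]_d -> R) :
  Omega !=set0 -> (forall j, flat_limit Phi X f (X j) = f (X j)) ->
  flat_limit_optimal Phi X Omega (flat_limit Phi X f).
Proof.
move=> O0 fX; split=> // delta _.
apply: le_trans (sup_norm_ge0 _ _ O0); apply/sup_norm_le0P => x _ /=.
rewrite /scaled_interpolant eqxx (flat_limit_data _ _ _ f) //.
exact: subrr.
Qed.

(** An interpolant has error zero at its own scale, so an optimal flat limit
    must have error zero for it as well. *)
Lemma interpolant_eq_flat_limit {R : realType} {d n : nat}
    {Phi : 'rV[R]_d -> R} {X : 'I_n -> 'rV[R]_d} (Omega : set 'rV[R]_d)
    (f : 'rV[R]_d -> R) (eps : R) :
  positive_definite Phi -> injective X -> 0 < eps ->
  flat_limit_optimal Phi X Omega (interpolant Phi X f eps) ->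
  forall x, Omega x -> interpolant Phi X f eps x = flat_limit Phi X f x.
Proof.
move=> pd Xinj e0 [_ /(_ _ (ltW e0))].
have sX j : interpolant Phi X f eps (X j) = f (X j) by exact: interpolant_node.
rewrite /scaled_interpolant eqxx (gt_eqF e0) (flat_limit_data _ _ _ f sX).
rewrite (interpolant_data _ _ _ f sX) => h x Ox; apply/eqP; rewrite -subr_eq0.
apply/eqP; move: x Ox; apply/sup_norm_le0P; apply: le_trans h _.
by apply/sup_norm_le0P => x _; exact: subrr.
Qed.

(** * Finite differences and positive definiteness *)

(** There is one more unknown weight than there are moment conditions.  Any
    solution does; the [N]-th finite difference, with its binomial weights, is
    one. *)
Lemma moment_annihilator (F : fieldType) (N : nat) :
  exists2 w : 'I_N.+1 -> F, exists l, w l != 0 &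
    forall q : {poly F}, (size q <= N)%N ->
      \sum_(l < N.+1) w l * q.[(l : nat)%:R] = 0.
Proof.
pose A : 'M[F]_(N.+1, N) := \matrix_(l, i) (l : nat)%:R ^+ i.
have : kermx A != 0.
  rewrite kermx_eq0 /row_free neq_ltn (leq_ltn_trans (rank_leq_col A)) //.
move=> /rowV0Pn[v /sub_kermxP vA v0].
exists (fun l => v ord0 l).
  apply: contrapT => h; move/eqP: v0; apply; apply/rowP => l; rewrite mxE.
  by apply/eqP/negPn/negP => hl; apply: h; exists l.
move=> q sq.
under eq_bigr => l _ do rewrite (horner_coef_wide _ sq) mulr_sumr.
rewrite exchange_big big1 //= => i _.
have /rowP/(_ i) := vA; rewrite !mxE => /(congr1 ( *%R q`_i)).
rewrite mulr0 => e; rewrite -[RHS]e mulr_sumr.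
by apply: eq_bigr => l _; rewrite mxE mulrCA.
Qed.

(** Allows pairs (node, shift) to serve as indices of the points. *)
Lemma positive_definite_fin {R : realType} {d : nat} {Phi : 'rV[R]_d -> R}
    (T : finType) (Z : T -> 'rV[R]_d) (c : T -> R) :
  positive_definite Phi -> injective Z -> (exists a, c a != 0) ->
  0 < \sum_(a : T) \sum_(b : T) c a * c b * Phi (Z a - Z b).
Proof.
move=> pd Zinj [a ca].
have reidx (F : T -> R) : \sum_(a : T) F a = \sum_(i < #|T|) F (enum_val i).
  by rewrite (reindex (@enum_val T T)) //; apply: onW_bij; exact: enum_val_bij.
rewrite reidx; under eq_bigr do rewrite reidx.
apply: (pd _ (fun i => Z (enum_val i)) (fun i => c (enum_val i))).
  by move=> i j /Zinj /enum_val_inj.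
by exists (enum_rank a); rewrite enum_rankK.
Qed.

(** With coefficients [c] of the interpolant, an annihilating difference [w]
    and a direction [h], the quadratic form of the weights [c j * w l] at the
    scaled points [eps *: Z (j, l)], where [Z (j, l) = X j + l *: h], equals
    [\sum_(i, k) c i * w k * \sum_l w l * Q (Z (i, k) - l *: h)], because
    summing over the nodes [j] first gives the interpolant.  Along the line
    through [X i] in the direction [h], [Q] is a polynomial which the
    difference annihilates, so the sum over [l] vanishes; by positive
    definiteness [c] is zero. *)
Lemma poly_interpolant_eq0 {R : realType} {d n : nat}
    {Phi : 'rV[R]_d -> R} {X : 'I_n -> 'rV[R]_d} (f Q : 'rV[R]_d -> R) :
  (0 < d)%N -> positive_definite Phi -> injective X ->
  poly_on_lines Q ->
  (forall x, \forall eps \near 0^'+, interpolant Phi X f eps x = Q x) ->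
  forall j, f (X j) = 0.
Proof.
move=> d0 pd Xinj hQ sQ.
pose i0 := Ordinal d0.
(* A step longer than all coordinate differences of nodes keeps the points
   Z (j, l) distinct. *)
pose tau := 1 + (\sum_(j < n) `|X j ord0 i0|) *+ 2.
pose h : 'rV[R]_d := const_mx tau.
have [q hq] := choice (fun i => hQ (X i) h).
pose N := (\max_(i < n) size (q i)).+1%N.
have [w [l0 wl0] wq] := moment_annihilator R N.
pose Z (a : 'I_n * 'I_N.+1) := X a.1 + (a.2 : nat)%:R *: h.
have XS i : `|X i ord0 i0| <= \sum_(j < n) `|X j ord0 i0|.
  by rewrite (bigD1 i) //= lerDl sumr_ge0.
have Zle i j (k l : 'I_N.+1) : Z (i, k) = Z (j, l) -> (k <= l)%N.
  move=> /(congr1 (fun x : 'rV[R]_d => x ord0 i0)); rewrite !mxE /= => e.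
  rewrite leqNgt; apply/negP => lk.
  have : tau <= X j ord0 i0 - X i ord0 i0.
    have -> : X j ord0 i0 - X i ord0 i0 = (k - l)%:R * tau.
      rewrite (natrB R (ltnW lk)) mulrBl; move: (X i ord0 i0) e => u e.
      by apply/eqP; rewrite subr_eq addrAC eq_sym subr_eq addrC e.
    rewrite ler_peMl ?ler1n ?subn_gt0 //.
    by rewrite addr_ge0 // mulrn_wge0 // sumr_ge0.
  apply/negP; rewrite -ltNge; apply: le_lt_trans (ler_norm _) _.
  apply: le_lt_trans (ler_normB _ _) _.
  by rewrite /tau mulr2n ltr_pwDl // lerD.
have Zinj : injective Z.
  move=> [i k] [j l] e.
  have kl : k = l.
    by apply/val_inj/anti_leq; rewrite (Zle _ _ _ _ e) (Zle _ _ _ _ (esym e)).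
  by move: e; rewrite /Z /= kl => /addIr /Xinj ->.
have sQa : \forall eps \near (0 : R)^'+, forall a : 'I_n * 'I_N.+1 * 'I_N.+1,
    interpolant Phi X f eps (Z a.1 - (a.2 : nat)%:R *: h) =
    Q (Z a.1 - (a.2 : nat)%:R *: h).
  by apply: filter_forall => a; exact: sQ.
have [eps [e0 sE]] := filter_ex (filterI (nbhs_right_gt (0 : R)) sQa).
set c := interp_coef Phi X f eps.
suff c0 : c = 0.
  move=> j; rewrite -(interpolant_node f eps j pd Xinj e0) /interpolant.
  rewrite big1 // => i _.
  by rewrite -/c c0 mxE mul0r.
apply/rowP => j; rewrite [RHS]mxE; apply/eqP/negPn/negP => cj.
have epsZinj : injective (fun a => eps *: Z a).
  by move=> a b /(scalerI (lt0r_neq0 e0)) /Zinj.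
have lamn0 : exists a : 'I_n * 'I_N.+1, c ord0 a.1 * w a.2 != 0.
  by exists (j, l0); apply: mulf_neq0.
have := positive_definite_fin _ _ _ pd epsZinj lamn0.
rewrite big1 ?ltxx // => -[i k] _.
rewrite (_ : \sum_b _ = c ord0 i * w k * \sum_(l < N.+1) w l *
    interpolant Phi X f eps (Z (i, k) - (l : nat)%:R *: h)); last first.
  rewrite mulr_sumr -(pair_bigA _ (fun i' l => _ * (c ord0 i' * w l) *
     Phi (eps *: Z (i, k) - eps *: Z (i', l)))) /= exchange_big /=.
  apply: eq_bigr => l _; rewrite /interpolant !mulr_sumr; apply: eq_bigr => m _.
  rewrite -/c -scalerBr -mulrA; congr (_ * _); rewrite mulrCA -!mulrA.
  congr (_ * (_ * Phi (_ *: _))).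
  by rewrite {2}/Z /= opprD addrA addrAC.
apply/eqP; rewrite mulf_eq0; apply/orP; right; apply/eqP.
(* The polynomial l |-> Q (X i + (k - l) *: h). *)
pose r := q i \Po (k%:R%:P - 'X).
rewrite -[RHS](wq r).
  apply: eq_bigr => l _; rewrite (sE (i, k, l)) /= /r horner_comp !hornerE hq.
  by rewrite /Z /= scalerBl addrA.
rewrite (leq_trans (size_comp_poly_leq _ _)) //.
rewrite -opprB size_polyN size_XsubC muln1 ltnS (leq_trans (leq_pred _)) //.
exact: (leq_bigmax i).
Qed.

(** * Spreading the flat limit from [Omega] to the whole space *)

(** The expansion replaces analytic continuation of [s eps] out of [Omega]:
    its coefficients are polynomials, so their vanishing spreads from [Omega].
    The price is that the range of scales depends on the point. *)
Lemma expansion_constant {R : realType} {d : nat} (P : nat -> 'rV[R]_d -> R)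
    (s : R -> 'rV[R]_d -> R) (Omega : set 'rV[R]_d) :
  (forall k, poly_on_lines (P k)) ->
  (forall x, \forall eps \near 0^'+,
     series (fun k => eps ^+ (2 * k) * P k x) m @[m --> \oo] --> s eps x) ->
  interior Omega !=set0 ->
  (forall x eps, Omega x -> 0 < eps -> s eps x = P 0%N x) ->
  forall x, \forall eps \near 0^'+, s eps x = P 0%N x.
Proof.
move=> hP hs O0 sP.
have P0 k x : P k.+1 x = 0.
  apply: (poly_on_lines_open_eq0 (P k.+1) Omega) => {x}// x Ox.
  have /nbhs_ballP[e /= e0 he] := hs x.
  apply: (power_series_tail_eq0 (P ^~ x) (e ^+ 2)) => [|t /andP[t0 te]].
    by rewrite exprn_gt0.
  have st0 : 0 < Num.sqrt t by rewrite sqrtr_gt0.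
  have : ball 0 e (Num.sqrt t).
    rewrite -ball_normE /ball_ /= sub0r normrN gtr0_norm //.
    by rewrite -(ltr_pXn2r (n := 2)) ?nnegrE ?ltW// sqr_sqrtr ?ltW.
  move=> /he /(_ st0); rewrite sP //.
  have -> // : (fun k => Num.sqrt t ^+ (2 * k) * P k x) =
      (fun k => t ^+ k * P k x).
  by apply/funext => l; rewrite exprM sqr_sqrtr // ltW.
move=> x; apply: filterS (hs x) => eps h.
suff h0 : series (fun k => eps ^+ (2 * k) * P k x) m @[m --> \oo] --> P 0%N x.
  exact: (cvg_unique (@norm_hausdorff _ R) h h0).
rewrite -(cvg_shiftS (series _)) /=.
have -> : (fun m => series (fun k => eps ^+ (2 * k) * P k x) m.+1) =
    (fun=> P 0%N x).
  apply/funext => m; rewrite seriesEnat /= big_nat_recl // expr0 mul1r.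
  by rewrite big1 ?addr0 // => k _; rewrite P0 mulr0.
exact: cvg_cst.
Qed.

(** * Functions with and without an optimal flat limit *)

Theorem theorem4 (R : realType) (d n : nat) (hd : (0 < d)%N)
  (Phi : 'rV[R]_d -> R)
  (hPhi_pd : positive_definite Phi) (hPhi_an : analytic_radial Phi)
  (X : 'I_n -> 'rV[R]_d) (hX : injective X)
  (hflat : flat_nondegenerate Phi X)
  (Omega : set 'rV[R]_d) (hOmega : interior Omega !=set0)
  (hXOmega : forall j, Omega (X j))
  (y : 'I_n -> R) :
  (exists f : 'rV[R]_d -> R,
     (forall j, f (X j) = y j) /\ flat_limit_optimal Phi X Omega f) /\
  ((exists j, y j != 0) ->
   exists f : 'rV[R]_d -> R,
     (forall j, f (X j) = y j) /\ ~ flat_limit_optimal Phi X Omega f).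
Proof.
have [g gy] : exists g : 'rV[R]_d -> R, forall j, g (X j) = y j.
  exists (fun x => if [pick j | X j == x] is Some j then y j else 0) => j.
  by case: pickP => [i /eqP /hX ->|/(_ j)]; rewrite ?eqxx.
have [p hp] := hflat; have [lim0 node0 _ expan] := hp g.
set P := fun k x => \sum_(i < n) g (X i) * poly_eval (p k i) x.
have limE x : flat_limit Phi X g x = P 0%N x.
  exact: (cvg_lim (@norm_hausdorff _ R) (lim0 x)).
split.
  exists (flat_limit Phi X g); split=> [j|]; first by rewrite limE -gy -node0.
  apply: flat_limit_optimal_self => [|j]; last by rewrite limE -[RHS]node0.
  by have [z /nbhs_singleton Oz] := hOmega; exists z.
move=> [j0 yj0]; apply: contrapT => no.
have opt f : (forall j, f (X j) = y j) -> flat_limit_optimal Phi X Omega f.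
  by move=> fy; apply: contrapT => nopt; apply: no; exists f.
have sP x eps : Omega x -> 0 < eps -> interpolant Phi X g eps x = P 0%N x.
  move=> Ox e0; rewrite -limE.
  apply: (interpolant_eq_flat_limit Omega) => //.
  by apply: opt => j; rewrite interpolant_node.
have P_line k : poly_on_lines (P k).
  exact: (poly_on_lines_comb (p k) (fun i => g (X i))).
move/eqP: yj0; apply; rewrite -gy.
apply: (poly_interpolant_eq0 g (P 0%N) hd hPhi_pd hX) => //.
exact: (expansion_constant P (interpolant Phi X g) Omega).
Qed.
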